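(* For the deterministic inventory model and the ordering policy $(\mathbf t,\mathbf y)$ described in the context, the long-term average cost satisfies $j_0(\mathbf t,\mathbf y)<\infty$.
   Context: Model. An ordering policy $(\mathbf t,\mathbf y)$ is a sequence of order times $t_k$ and nonnegative order sizes $y_k$, and the inventory process is $x(t)=-t+\sum_kI_{\{t_k\le t\}}y_k$ (initial level $0$ before any order; demand rate $1$). Costs: $c_0(x)=2|x|$ for $x\in\mathbb R$; $c_1(y,z)=k_1+(z-y)$ for $y\le z$, with constant $k_1>0$ (orders of size $0$ cost $k_1$). The long-term average cost is $$j_0(\mathbf t,\mathbf y)=\limsup_{t\to\infty}\frac1t\Big(\int_0^tc_0(x(s))\,ds+\sum_kI_{\{t_k\le t\}}c_1(x(t_k-),x(t_k))\Big).$$ Policy. Orders are indexed by pairs $(i,j)$: cycle $i=1,2,3,\dots$ and order number $j=1,\dots,2^i+1$ within cycle $i$ (listed lexicographically this gives the single-index sequence). Set $t_{1,1}=0$ and, for $i\ge2$, $t_{i,1}=t_{i-1,2^{i-1}+1}+2^{(i-2)/2}$. For each $i\ge1$: Phase 1: $y_{i,1}=1$, and $t_{i,j}=t_{i,j-1}+1$, $y_{i,j}=1$ for $j=2,\dots,2^{i-1}$. Phase 2: $t_{i,2^{i-1}+1}=t_{i,2^{i-1}}+1$, $y_{i,2^{i-1}+1}=2^{(i-1)/2}$; and $t_{i,2^{i-1}+1+j}=t_{i,2^{i-1}+1}$, $y_{i,2^{i-1}+1+j}=0$ for $j=1,\dots,2^{i-1}$. Thus each nonzero order is placed when the level hits $0$;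 cycle $i$ ends when $x$ hits $0$ at time $t_{i+1,1}$. Convention. $(x(t_k-),x(t_k))$ denotes the levels just before and just after order $k$; simultaneous orders are applied one after another, so each $0$-size order of cycle $i$ contributes the pair $(2^{(i-1)/2},2^{(i-1)/2})$, the preceding large order contributes $(0,2^{(i-1)/2})$, and each Phase 1 order (including that at time $0$) contributes $(0,1)$. *)

(* Defs.v *)
From HB Require Import structures.
From mathcomp Require Import all_boot all_order all_algebra.
From mathcomp Require Import all_classical all_reals all_analysis.
Set Implicit Arguments.
Unset Strict Implicit.
Unset Printing Implicit Defensive.
Import Order.TTheory GRing.Theory Num.Theory.
Import numFieldNormedType.Exports.
Local Open Scope classical_set_scope.
Local Open Scope ring_scope.

(* Orders are numbered 0, 1, 2, ... in the order in which they are applied;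
   simultaneous orders are allowed. *)
Record policy (R : realType) := Policy {
  order_time : nat -> R;
  order_size : nat -> R;
  order_time_ge0 : forall k, 0 <= order_time k;
  order_time_ndecr : forall k, order_time k <= order_time k.+1;
  order_size_ge0 : forall k, 0 <= order_size k
}.

Section InventoryModel.
Context {R : realType}.
Implicit Types (p : policy R) (t : R).

(* The series is a real-valued limit, hence meaningful when the orders placed
   by time t have finite total size.  If infinitely many orders were placed by
   time t, [total_order_cost] would be +oo there in any case, since k1 > 0. *)
Definition inventory p t : R :=
  - t + limn (fun n => \sum_(0 <= k < n | order_time p k <= t) order_size p k).

(* Levels just before and just after order k.  Simultaneous orders are applied
   one after another, so [level_before] accounts for all earlier orders,
   including those placed at the same time. *)
Definition level_before p (k : nat) : R :=
  - order_time p k + \sum_(0 <= l < k) order_size p l.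

Definition level_after p (k : nat) : R :=
  level_before p k + order_size p k.

Definition holding_cost (x : R) : R := 2 * `|x|.

(* Only used for y <= z. *)
Definition ordering_cost (k1 y z : R) : R := k1 + (z - y).

Definition total_holding_cost p t : \bar R :=
  (\int[lebesgue_measure]_(s in `[0%R, t]) (holding_cost (inventory p s))%:E)%E.

Definition total_order_cost (k1 : R) p t : \bar R :=
  (\sum_(0 <= k <oo | (order_time p k <= t)%R)
     (ordering_cost k1 (level_before p k) (level_after p k))%:E)%E.

Definition average_cost (k1 : R) p : \bar R :=
  limf_esup
    (fun t : R =>
       ((t^-1)%:E * (total_holding_cost p t + total_order_cost k1 p t))%E)
    +oo%R.

End InventoryModel.

(* Pairs (i, j) with 1 <= i and 1 <= j <= 2 ^ i + 1, listed lexicographically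
   from (1, 1). *)
Definition next_pair (ij : nat * nat) : nat * nat :=
  (if ij.2 <= 2 ^ ij.1 then (ij.1, ij.2.+1) else (ij.1.+1, 1))%N.

Definition nth_pair (k : nat) : nat * nat := iter k next_pair (1, 1)%N.

Section TwoPhasePolicy.
Context {R : realType}.

(* Time of order j of cycle i when the first order of the cycle is at time s:
   orders 2, ..., 2 ^ (i - 1) + 1 each come one time unit after the preceding
   order, and the remaining ones are simultaneous with it. *)
Fixpoint cycle_time (s : R) (i j : nat) : R :=
  if j is j'.+1 then
    if (j' == 0)%N then s
    else if (j' <= 2 ^ i.-1)%N then cycle_time s i j' + 1
    else cycle_time s i j'
  else s.

(* t_{i,1}; in the recursive branch i = i'.+1 >= 2, and
   t_{i,1} = t_{i-1, 2^(i-1) + 1} + 2^((i-2)/2). *)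
Fixpoint cycle_start (i : nat) : R :=
  if i is i'.+1 then
    if (i' == 0)%N then 0
    else cycle_time (cycle_start i') i' (2 ^ i' + 1)%N + 2 `^ ((i%:R - 2) / 2)
  else 0.

Definition pair_time (i j : nat) : R := cycle_time (cycle_start i) i j.

Definition pair_size (i j : nat) : R :=
  if (j <= 2 ^ i.-1)%N then 1
  else if (j == 2 ^ i.-1 + 1)%N then 2 `^ ((i%:R - 1) / 2)
  else 0.

Lemma pair_time_first : pair_time 1 1 = 0.
Proof. by []. Qed.

Lemma pair_time_next_cycle (i : nat) : (2 <= i)%N ->
  pair_time i 1 = pair_time i.-1 (2 ^ i.-1 + 1)%N + 2 `^ ((i%:R - 2) / 2).
Proof. by case: i => [|[|i]]. Qed.

Lemma pair_time_unit_step (i j : nat) : (2 <= j <= 2 ^ i.-1 + 1)%N ->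
  pair_time i j = pair_time i j.-1 + 1.
Proof.
by case: j => [|[|j]] //=; rewrite addn1 ltnS /pair_time /= => ->.
Qed.

Lemma pair_time_simultaneous (i j : nat) :
  pair_time i (2 ^ i.-1 + 1 + j)%N = pair_time i (2 ^ i.-1 + 1)%N.
Proof.
elim: j => [|j IHj]; first by rewrite addn0.
rewrite -IHj addnS /pair_time /=.
by rewrite addn1 addSn /= ltnNge leq_addr.
Qed.

Lemma nth_pair_valid (k : nat) :
  [&& 1 <= (nth_pair k).1, 1 <= (nth_pair k).2
    & (nth_pair k).2 <= 2 ^ (nth_pair k).1 + 1]%N.
Proof.
elim: k => //= k; rewrite /next_pair.
case: (nth_pair k) => i j /= /and3P[i1 j1 jle].
case: ifP => /= [jle'|_]; first by rewrite i1 addn1 ltnS jle'.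
by rewrite addn1.
Qed.

Lemma pair_time_le_next (i j : nat) : (1 <= i)%N -> (1 <= j)%N ->
  (j <= 2 ^ i + 1)%N ->
  pair_time i j <= pair_time (next_pair (i, j)).1 (next_pair (i, j)).2.
Proof.
move=> i1 j1 jle; rewrite /next_pair /=; case: ifPn => /= [_|].
  case: j j1 {jle} => // j _; rewrite /pair_time.
  have -> s : cycle_time s i j.+2 =
      if (j.+1 <= 2 ^ i.-1)%N then cycle_time s i j.+1 + 1
      else cycle_time s i j.+1 by [].
  by case: ifP => _ //; rewrite lerDl.
rewrite -ltnNge => jgt.
have -> : j = (2 ^ i + 1)%N by apply/eqP; rewrite eqn_leq jle addn1.
by rewrite (pair_time_next_cycle (i := i.+1)) //= lerDl powR_ge0.
Qed.

Lemma nth_time_ndecr (k : nat) :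
  pair_time (nth_pair k).1 (nth_pair k).2 <=
  pair_time (nth_pair k.+1).1 (nth_pair k.+1).2.
Proof.
have := nth_pair_valid k; rewrite /nth_pair iterS -/(nth_pair k).
case: (nth_pair k) => i j /and3P[]; exact: pair_time_le_next.
Qed.

Lemma nth_time_ge0 (k : nat) : 0 <= pair_time (nth_pair k).1 (nth_pair k).2.
Proof. by elim: k => // k IHk; exact: le_trans IHk (nth_time_ndecr k). Qed.

Lemma pair_size_ge0 (i j : nat) : 0 <= pair_size i j.
Proof. by rewrite /pair_size; do 2 case: ifP => _ //; exact: powR_ge0. Qed.

Definition two_phase_policy : policy R :=
  @Policy R (fun k => pair_time (nth_pair k).1 (nth_pair k).2)
    (fun k => pair_size (nth_pair k).1 (nth_pair k).2)
    nth_time_ge0 nth_time_ndecr (fun k => pair_size_ge0 _ _).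

End TwoPhasePolicy.

Arguments two_phase_policy R : clear implicits.

(* Main.v *)
(* Cycle i lasts at least 2^(i-1) time units and contains 2^i + 1 orders, so
   the number of orders placed by time t is O(t). The large order of cycle i
   raises the level to Q_i = 2^((i-1)/2), which takes time Q_i to deplete; hence
   it adds at most 2 Q_i^2 = 2^i to the holding cost, while outside these
   depletion periods the level stays in [0, 1]. Both costs are therefore O(t). *)

Require Import Defs.
From mathcomp Require Import all_boot all_order all_algebra.
From mathcomp Require Import all_classical all_reals all_analysis.
From mathcomp Require Import measurable_realfun zify lra.

Set Implicit Arguments.
Unset Strict Implicit.
Unset Printing Implicit Defensive.
Import Order.TTheory GRing.Theory Num.Theory.
Import numFieldNormedType.Exports.
Local Open Scope ring_scope.

(** * Tools on integrals, measures of segments and limits superior at infinity *)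

Section LebesgueIntegral.
Local Open Scope classical_set_scope.

(* The integral of a nonnegative function is a supremum over the simple
   functions below it, so no measurability is required. *)
Lemma ge0_le_integral_nomeas d (T : measurableType d) (R : realType)
    (mu : {measure set T -> \bar R}) (D : set T) (f g : T -> \bar R) :
  (forall x, D x -> (0 <= f x)%E) -> (forall x, D x -> (f x <= g x)%E) ->
  (\int[mu]_(x in D) f x <= \int[mu]_(x in D) g x)%E.
Proof.
move=> f0 fg; have g0 x : D x -> (0 <= g x)%E.
  by move=> Dx; exact: le_trans (f0 x Dx) (fg x Dx).
rewrite !ge0_integralE //; apply: ge_ereal_sup => _ /= [h hf <-].
apply: ereal_sup_ubound; exists h => // x.
apply: le_trans (hf x) _; rewrite /patch; case: ifPn => // /set_mem.
exact: fg.
Qed.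

Lemma lebesgue_measure_segment (R : realType) (a b : R) : a <= b ->
  (lebesgue_measure : {measure set (measurableTypeR R) -> \bar R}) `[a, b] =
  (b - a)%:E.
Proof.
move=> ab; have := lebesgue_measure_itv `[a, b]%R; rewrite /= => ->.
rewrite lte_fin; case: ltP => [_|ba]; first by rewrite EFinB.
by rewrite (@le_anti _ _ a b) ?ab // subrr.
Qed.

End LebesgueIntegral.

Lemma limf_esup_pinfty_le (R : realType) (f : R -> \bar R) (a : R)
    (c : \bar R) :
  (forall t, a <= t -> (f t <= c)%E) -> (limf_esup f +oo%R <= c)%E.
Proof.
move=> fc; rewrite limf_esupE; apply: ge_ereal_inf.
exists (ereal_sup [set f x | x in [set t | a <= t]])%classic.
  exists [set t | a <= t]%classic => //.
  by apply: nbhs_pinfty_ge; exact: num_real.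
by apply: ge_ereal_sup => _ /= [t ta <-]; exact: fc.
Qed.

(** * Inventory level and ordering cost of an arbitrary policy *)

Section Policy.
Variables (R : realType) (p : policy R).
Implicit Types (k : nat) (s t : R).

Lemma order_time_nondecreasing k l :
  (k <= l)%N -> order_time p k <= order_time p l.
Proof.
move=> /subnKC <-; elim: (l - k)%N => [|m IHm]; first by rewrite addn0.
by rewrite addnS; exact: le_trans IHm (order_time_ndecr p _).
Qed.

(** The strict upper bound makes [k] the last of its batch of simultaneous orders, so a condition on
    times becomes one on indices. *)
Lemma order_time_le k l s : order_time p k <= s < order_time p k.+1 ->
  (order_time p l <= s) = (l <= k)%N.
Proof.
move=> /andP[ks sk]; case: leqP => [lk|kl].
  by rewrite (le_trans (order_time_nondecreasing lk)).
apply/negbTE; rewrite -ltNge; apply: lt_le_trans sk _.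
exact: order_time_nondecreasing.
Qed.

Lemma sum_orders_le (F : nat -> R) k n s :
  order_time p k <= s < order_time p k.+1 -> (k < n)%N ->
  \sum_(0 <= l < n | order_time p l <= s) F l = \sum_(0 <= l < k.+1) F l.
Proof.
move=> ks kn; rewrite (big_nat_widen _ _ _ _ _ kn).
by apply: eq_bigl => l; rewrite (order_time_le _ ks) ltnS.
Qed.

(** The partial sums in [inventory] are constant from [n = k.+1] on, so the limit is a finite
    sum. *)
Lemma inventoryE k s : order_time p k <= s < order_time p k.+1 ->
  inventory p s = level_after p k - (s - order_time p k).
Proof.
move=> ks; rewrite /inventory /level_after /level_before.
rewrite (@lim_near_cst _ _ _ _ _ (\sum_(0 <= l < k.+1) order_size p l)).
- by rewrite big_nat_recr //=; lra.
- exact: norm_hausdorff.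
- near=> n; apply: (sum_orders_le _ ks).
  by near: n; exact: nbhs_infty_ge.
Unshelve. all: by end_near.
Qed.

Lemma level_beforeS k : level_before p k.+1 =
  level_after p k - (order_time p k.+1 - order_time p k).
Proof. by rewrite /level_after /level_before big_nat_recr //=; lra. Qed.

(** The proportional cost of an order is its size, and the sizes up to order [k] add up to the level
    after it plus the demand [order_time p k] met so far. *)
Lemma total_order_costE (k1 : R) k t : 0 <= k1 ->
  order_time p k <= t < order_time p k.+1 ->
  total_order_cost k1 p t =
  (k1 * k.+1%:R + level_after p k + order_time p k)%:E.
Proof.
move=> k10 kt; rewrite /total_order_cost.
have cost l : ordering_cost k1 (level_before p l) (level_after p l)
    = k1 + order_size p l by rewrite /ordering_cost /level_after; lra.
under eq_eseriesr do rewrite cost.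
rewrite (nneseries_split_cond 0 k.+1) => [|l _]; last first.
  by rewrite lee_fin addr_ge0 ?order_size_ge0.
rewrite add0n eseries0 => [|l kl]; last first.
  by rewrite (order_time_le _ kt) leqNgt kl.
rewrite adde0 sumEFin (sum_orders_le _ kt) //.
rewrite big_split /= sumr_const_nat subn0 -mulr_natr big_nat_recr //=.
by rewrite /level_after /level_before; congr (_%:E); lra.
Qed.

End Policy.

(** * Closed forms for the times and sizes of the two-phase policy *)

Section TwoPhase.
Variable R : realType.
Local Notation p := (two_phase_policy R).
Implicit Types (i j k : nat) (s t : R).

(** The quantity Q_i: the size of the large order of cycle [i], and also the time needed to deplete
    it. *)
Definition big_size i : R := 2 `^ ((i%:R - 1) / 2).
Definition big_time i : R := pair_time i (2 ^ i.-1 + 1).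

Lemma big_size_sqr i : (0 < i)%N -> big_size i ^+ 2 = 2 ^+ i.-1.
Proof.
case: i => // i _; rewrite -powR_mulrn ?powR_ge0 // -powRrM divfK ?pnatr_eq0 //.
by rewrite -[i.+1]addn1 natrD addrK addn1 powR_mulrn.
Qed.

Lemma big_size_ge0 i : 0 <= big_size i.
Proof. exact: powR_ge0. Qed.

(** Since Q_i^2 = 2^(i-1) >= 1, also Q_i >= 1, whence Q_i <= Q_i^2. *)
Lemma big_size_le i : (0 < i)%N -> big_size i <= 2 ^+ i.-1.
Proof.
move=> i0; have := big_size_sqr i0; have := big_size_ge0 i.
have : 1 <= 2 ^+ i.-1 :> R by rewrite exprn_ege1 // ler1n.
nra.
Qed.

Lemma pair_time_phase1 i j : (j <= 2 ^ i.-1)%N ->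
  pair_time i j.+1 = cycle_start i + j%:R :> R.
Proof.
elim: j => [|j IHj] ji; first by rewrite /pair_time /= addr0.
rewrite pair_time_unit_step ?addn1 //= IHj ?(ltnW ji) // -[j.+1]addn1 natrD.
lra.
Qed.

Lemma pair_time_phase2 i j : (2 ^ i.-1 < j)%N -> pair_time i j = big_time i.
Proof.
move=> ij; rewrite /big_time -(pair_time_simultaneous i (j - (2 ^ i.-1 + 1))).
by rewrite subnKC // addn1.
Qed.

Lemma big_timeE i : big_time i = cycle_start i + 2 ^+ i.-1.
Proof. by rewrite /big_time addn1 pair_time_phase1 // natrX. Qed.

Lemma cycle_startS i : (0 < i)%N ->
  cycle_start i.+1 = big_time i + big_size i.
Proof.
case: i => // i _; have -> : cycle_start i.+2 = pair_time i.+2 1 :> R by [].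
rewrite pair_time_next_cycle // pair_time_phase2 /=; last first.
  by rewrite expnS; have := expn_gt0 2 i; lia.
rewrite /big_size; do 3 f_equal.
by rewrite -[i.+2]addn1 natrD; lra.
Qed.

(** The first phases of the earlier cycles alone last 1 + 2 + ... + 2^(i-2) time units. *)
Lemma cycle_start_ge i : (0 < i)%N -> 2 ^+ i.-1 - 1 <= cycle_start i :> R.
Proof.
elim: i => // -[|i] IHi _; first by rewrite /= expr0; lra.
rewrite cycle_startS // big_timeE /=.
have := IHi isT; have := big_size_ge0 i.+1.
by rewrite exprS /=; lra.
Qed.

(** * Position of each order in the enumeration, and the level it meets *)

Lemma nth_pairS k : nth_pair k.+1 = next_pair (nth_pair k).
Proof. by []. Qed.

(** Cycle c has 2^c + 1 orders, so 2^i + i - 3 orders precede cycle i; adding 4 avoids truncated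
    subtraction. *)
Lemma nth_pair_index k : (k + 4 = 2 ^ (nth_pair k).1 + (nth_pair k).1
  + (nth_pair k).2)%N.
Proof.
elim: k => // k IHk; have := nth_pair_valid k; move: IHk; rewrite nth_pairS.
case: (nth_pair k) => i j /=; rewrite /next_pair /=.
by case: (leqP j (2 ^ i)) => /= ji; rewrite ?expnS; lia.
Qed.

(** Induction along the orders: a unit order is used up in one time unit, the large one at the end
    of its cycle, and only the zero orders find a positive level. *)
Lemma level_before_two_phase k : level_before p k =
  if ((nth_pair k).2 <= 2 ^ (nth_pair k).1.-1 + 1)%N then 0
  else big_size (nth_pair k).1.
Proof.
elim: k => [|k IHk].
  by rewrite /level_before big_nil /= addr0 oppr0.
rewrite level_beforeS /level_after IHk /= -/(nth_pair k).
have := nth_pair_valid k; case: (nth_pair k) => -[//|i] [//|j] /= ji.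
have i0 : (0 < 2 ^ i)%N by rewrite expn_gt0.
have i1 : (2 ^ i.+1 = 2 * 2 ^ i)%N by rewrite expnS.
rewrite /next_pair /pair_size /=; case: (leqP j.+1 (2 ^ i.+1)) => /= ji1.
  case: (leqP j.+1 (2 ^ i)) => ji2.
    rewrite !ifT; [|lia|lia].
    by rewrite pair_time_unit_step /=; [lra|lia].
  rewrite (@pair_time_phase2 i.+1 j.+2) ?(@pair_time_phase2 i.+1 j.+1) /=;
    [|lia|lia].
  have -> : (j.+2 <= 2 ^ i + 1)%N = false by apply/negbTE; lia.
  case: eqP => ji3.
    by rewrite ifT; [rewrite /big_size; lra|lia].
  by rewrite ifF; [lra|apply/negbTE; lia].
(* Order [j.+1] closes cycle [i.+1]; the next cycle starts after the depletion time, at level 0. *)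
have -> : (1 <= 2 ^ i.+1 + 1)%N by lia.
have -> : (j.+1 <= 2 ^ i + 1)%N = false by apply/negbTE; lia.
have -> : (j.+1 <= 2 ^ i)%N = false by apply/negbTE; lia.
have -> : (j.+1 == 2 ^ i + 1)%N = false by apply/negbTE; lia.
rewrite (@pair_time_phase2 i.+1 j.+1) /=; last lia.
have -> : pair_time i.+2 1 = cycle_start i.+2 by [].
by rewrite cycle_startS //; lra.
Qed.

(** * Growth of the order times *)

Lemma order_time_ge k : 2 ^+ (nth_pair k).1.-1 - 1 <= order_time p k.
Proof.
rewrite /=; have := nth_pair_valid k.
case: (nth_pair k) => i j /= /and3P[i0 j0 _].
apply: le_trans (cycle_start_ge i0) _; case: j j0 => // j _.
case: (leqP j (2 ^ i.-1)) => ji.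
  by rewrite pair_time_phase1 // lerDl.
by rewrite pair_time_phase2 ?big_timeE ?lerDl ?exprn_ge0 // (leq_trans ji).
Qed.

(** An order of cycle i has k + 4 <= 8 * 2^(i-1) by [nth_pair_index], while its time is at least
    2^(i-1) - 1. *)
Lemma index_le_order_time k : k%:R <= 8 * (order_time p k + 1) - 4.
Proof.
have := order_time_ge k; have := nth_pair_index k; have := nth_pair_valid k.
case: (nth_pair k) => -[//|i] j /= ji kE.
have : (k + 4 <= 8 * 2 ^ i)%N.
  by have := ltn_expl i (leqnn 2); move: ji kE; rewrite expnS; lia.
rewrite -(ler_nat R) natrD natrM natrX; lra.
Qed.

Lemma order_time_bracket s : 0 <= s ->
  exists k, order_time p k <= s < order_time p k.+1.
Proof.
move=> s0.
have ex : exists k, s < order_time p k.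
  (* As [n] exceeds 8 (s + 1), the linear bound on indices forces order [n] to come after [s]. *)
  set n := (Num.truncn (8 * (s + 1))).+1; exists n.
  have := index_le_order_time n; have := truncnS_gt (8 * (s + 1)).
  by rewrite -/n; lra.
case: (ex_minnP ex) => -[|k] ks kmin.
  by move: ks; rewrite /= ltNge s0.
exists k; rewrite ks andbT leNgt; apply/negP => /kmin; lia.
Qed.

(** * Bounds on the level and on the holding cost *)

Lemma inventory_bound k s : order_time p k <= s < order_time p k.+1 ->
  let i := (nth_pair k).1 in
  0 <= inventory p s <= 1 \/
  0 <= inventory p s <= big_size i /\
    big_time i <= s <= big_time i + big_size i.
Proof.
move=> ks; rewrite (inventoryE ks) /level_after level_before_two_phase.
move: ks; rewrite /= -/(nth_pair k).
have := nth_pair_valid k; case: (nth_pair k) => -[//|i] [//|j] /= ji.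
have i0 : (0 < 2 ^ i)%N by rewrite expn_gt0.
have i1 : (2 ^ i.+1 = 2 * 2 ^ i)%N by rewrite expnS.
rewrite /next_pair /pair_size /=; case: (leqP j.+1 (2 ^ i.+1)) => /= ji1.
  case: (leqP j.+1 (2 ^ i)) => ji2.
    rewrite ifT; last lia.
    by rewrite (@pair_time_unit_step _ i.+1 j.+2) /= => [ks|]; [left; lra|lia].
  (* The next order is simultaneous with this one, so [ks] describes an empty interval. *)
  by rewrite (@pair_time_phase2 i.+1 j.+2) ?(@pair_time_phase2 i.+1 j.+1) /=;
    [lra|lia|lia].
have -> : (j.+1 <= 2 ^ i + 1)%N = false by apply/negbTE; lia.
have -> : (j.+1 <= 2 ^ i)%N = false by apply/negbTE; lia.
have -> : (j.+1 == 2 ^ i + 1)%N = false by apply/negbTE; lia.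
rewrite (@pair_time_phase2 i.+1 j.+1) /=; last lia.
have -> : pair_time i.+2 1 = cycle_start i.+2 by [].
by rewrite cycle_startS // => ks; right; lra.
Qed.

(** The constant covers levels in [0, 1], each summand one depletion period. The bound on [s] puts
    its cycle among the first [n], since cycle i starts no earlier than 2^(i-1) - 1. *)
Lemma holding_cost_bound n s : 0 <= s -> s + 1 < 2 ^+ n ->
  holding_cost (inventory p s) <= 2 + \sum_(0 <= m < n)
    2 * big_size m.+1 *
    \1_(`[big_time m.+1, big_time m.+1 + big_size m.+1]%classic) s.
Proof.
move=> s0 sn; have [k ks] := order_time_bracket s0.
have sum0 (P : pred nat) : 0 <= \sum_(0 <= m < n | P m) 2 * big_size m.+1 *
    \1_(`[big_time m.+1, big_time m.+1 + big_size m.+1]%classic) s.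
  by apply: sumr_ge0 => m _; rewrite !mulr_ge0 ?big_size_ge0 ?indicE.
rewrite /holding_cost; have := inventory_bound ks => /= -[/andP[x0 x1]|].
  by rewrite ger0_norm //; have := sum0 xpredT; lra.
move: (order_time_ge k) (nth_pair_valid k) ks.
case: (nth_pair k) => -[//|i] j /= tk _ /andP[ks _] [/andP[x0 xQ] sB].
have iN : (i < n)%N by rewrite -(ltr_eXn2l (x := 2 : R)) ?ltr1n //; lra.
(* The summand of the current cycle suffices; the others are nonnegative. *)
rewrite ger0_norm // (bigD1_seq i) ?mem_index_iota ?iota_uniq //=.
rewrite indicE mem_set ?mulr1 /=; last by rewrite in_itv.
have := sum0 (fun m => m != i); lra.
Qed.

(** The constant integrates to 2t, and cycle m+1 contributes at most 2 Q_(m+1)^2 = 2 * 2^m, which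
    sums geometrically. *)
Lemma total_holding_cost_le n t : 0 <= t -> t + 1 < 2 ^+ n ->
  (total_holding_cost p t <= (2 * t + 2 * (2 ^+ n - 1))%:E)%E.
Proof.
move=> t0 tn; rewrite /total_holding_cost.
pose A m : set R := `[big_time m.+1, big_time m.+1 + big_size m.+1]%classic.
pose g m s : \bar R := ((2 * big_size m.+1)%:E * (\1_(A m) s)%:E)%E.
apply: (@le_trans _ _ (\int[lebesgue_measure]_(s in `[0%R, t]%classic)
    (2%:E + \sum_(0 <= m < n) g m s))%E).
  apply: ge0_le_integral_nomeas => s.
    by move=> _; rewrite lee_fin mulr_ge0.
  rewrite /= in_itv /= => /andP[s0 st].
  rewrite /g; under eq_bigr do rewrite -EFinM; rewrite sumEFin -EFinD lee_fin.
  by apply: holding_cost_bound => //; lra.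
have mD : measurable (`[0, t]%classic : set R) by [].
have mA m : measurable (A m) by exact: measurable_itv.
have g0 m s : (0 <= g m s)%E.
  by rewrite mule_ge0 // lee_fin ?mulr_ge0 ?big_size_ge0.
have mi m : measurable_fun `[0, t]%classic (EFin \o (\1_(A m) : R -> R)).
  by apply/measurable_EFinP; exact: measurable_indic.
have mg m : measurable_fun `[0, t]%classic (g m).
  exact: (measurable_funeM (2 * big_size m.+1)%:E (mi m)).
rewrite ge0_integralD //; last 2 first.
- by move=> s _; exact: sume_ge0.
- by apply: emeasurable_sum => m _; exact: mg.
rewrite integral_cst // ge0_integral_sum //.
rewrite (EFinD (2 * t)); apply: leeD.
  by rewrite lebesgue_measure_segment // -EFinM lee_fin; lra.
have -> : 2 * (2 ^+ n - 1) = \sum_(0 <= m < n) 2 * 2 ^+ m :> R.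
  by rewrite -mulr_sumr big_mkord subrX1 (_ : 2 - 1 = 1 :> R) ?mul1r; last lra.
rewrite -sumEFin; apply: lee_sum => m _.
rewrite ge0_integralZl ?lee_fin ?mulr_ge0 ?big_size_ge0 //; last first.
  exact: mi.
rewrite integral_indic //; last exact: mA.
(* A depletion period may extend beyond [0, t]; it is counted in full. *)
apply: (@le_trans _ _ ((2 * big_size m.+1)%:E *
    (lebesgue_measure : {measure set (measurableTypeR R) -> \bar R}) (A m))%E).
  rewrite lee_wpmul2l ?lee_fin ?mulr_ge0 ?big_size_ge0 // le_measure ?inE //.
    by apply: measurableI; [exact: mA|].
  exact: mA.
rewrite lebesgue_measure_segment ?lerDl ?big_size_ge0 // -EFinM lee_fin.
by rewrite addrAC subrr add0r -mulrA -expr2 big_size_sqr.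
Qed.

(** * Linear bound on the total cost *)

Lemma total_cost_le (k1 t : R) : 0 <= k1 -> 1 <= t ->
  (total_holding_cost p t + total_order_cost k1 p t
    <= ((14 + 13 * k1) * t)%:E)%E.
Proof.
move=> k10 t1; have t0 : 0 <= t by lra.
have exn : exists n, t + 1 < 2 ^+ n.
  exists (Num.truncn (t + 1)).+1.
  apply: lt_trans (truncnS_gt _) _.
  by rewrite -natrX ltr_nat ltn_expl.
(* Minimality of the exponent keeps 2^(n+1) at most 2 (t + 1), so the holding cost is at most 6t +
   2. *)
case: (ex_minnP exn) => -[|n] tn nmin.
  by exfalso; move: tn; rewrite expr0; lra.
have nt : 2 ^+ n <= t + 1 by rewrite leNgt; apply/negP => /nmin; lia.
have hold := total_holding_cost_le t0 tn.
have [k kt] := order_time_bracket t0.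
(* The level after an order is at most 1 or Q_i, and Q_i <= 2^(i-1) <= t + 1. *)
have level : level_after p k <= t + 2.
  rewrite /level_after level_before_two_phase.
  have := order_time_ge k; move: kt => /andP[kt _]; move: kt.
  have := nth_pair_valid k; rewrite /= -/(nth_pair k).
  case: (nth_pair k) => i j /= /and3P[i0 j0 ji] kt ge.
  have := big_size_le i0; rewrite /pair_size -/(big_size i).
  have e0 : (0 < 2 ^ i.-1)%N by rewrite expn_gt0.
  case: (leqP j (2 ^ i.-1)) => ji1.
    by rewrite ifT; [lra|lia].
  case: eqP => ji2; first by rewrite ifT; [lra|lia].
  by rewrite ifF; [lra|apply/negbTE; lia].
rewrite (total_order_costE k10 kt).
apply: le_trans (leeD hold (lexx _)) _; rewrite -EFinD lee_fin exprS.
move: kt => /andP[kt _]; have := index_le_order_time k.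
rewrite -[k.+1]addn1 natrD => kt8.
(* Here k + 1 <= 8t + 5 <= 13t as t >= 1; the terms without [k1] total at most 8t + 4 <= 14t. *)
have : k1 * (k%:R + 1) <= k1 * (13 * t) by apply: ler_wpM2l => //; lra.
lra.
Qed.

End TwoPhase.

Theorem proposition2p3 (R : realType) (k1 : R) (hk1 : 0 < k1) :
  (average_cost k1 (two_phase_policy R) < +oo)%E.
Proof.
apply: (@le_lt_trans _ _ (14 + 13 * k1)%:E); last exact: ltry.
apply: (@limf_esup_pinfty_le _ _ 1) => t t1.
have t0 : 0 < t by lra.
apply: le_trans (lee_wpmul2l _ (total_cost_le (ltW hk1) t1)) _.
  by rewrite lee_fin invr_ge0 ltW.
by rewrite -EFinM lee_fin mulrCA mulVf ?mulr1 // gt_eqF.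
Qed.
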